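(* Let $\beta>1$ be a real number, let $T_\beta:[0,1]\to[0,1]$, $T_\beta(x)=\beta x \bmod 1$, and let $\mu$ be the Parry measure of $T_\beta$. Let $\psi:\mathbb{N}\to(0,\infty)$ be a positive function and $$R(T_\beta,\psi)=\{x\in[0,1]:\ |T_\beta^nx-x|<\psi(n)\ \text{for infinitely many } n\in\mathbb{N}\}.$$ Then $$\mu(R(T_\beta,\psi))=\begin{cases}0 & \text{if } \sum_{n=1}^\infty\psi(n)<\infty,\\ 1 & \text{if } \sum_{n=1}^\infty\psi(n)=\infty.\end{cases}$$
   Context: $\beta x\bmod 1$ denotes the fractional part of $\beta x$. The Parry measure $\mu$ is the $T_\beta$-invariant probability measure on $[0,1]$, equivalent to Lebesgue measure, with density $$h(x)=\Big(\int_0^1\sum_{n\ge0:\ x<T_\beta^n1}\beta^{-n}\,dx\Big)^{-1}\sum_{n\ge0:\ x<T_\beta^n1}\beta^{-n},$$ where $T_\beta^01=1$. *)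

(* Defs.v *)
From HB Require Import structures.
From mathcomp Require Import all_boot all_order all_algebra.
From mathcomp Require Import all_classical all_reals all_analysis.
From mathcomp Require Import measurable_realfun.

Set Implicit Arguments.
Unset Strict Implicit.
Unset Printing Implicit Defensive.

Import Order.TTheory GRing.Theory Num.Theory.
Import numFieldNormedType.Exports.

Local Open Scope classical_set_scope.
Local Open Scope ring_scope.

Section beta_transformation.
Context {R : realType}.
Implicit Types (beta x : R) (psi : nat -> R).

(* The map is total on R; the unit interval is imposed in the sets and measures
   below. At x = 1 the value is the fractional part of beta. *)
Definition beta_map beta x : R := beta * x - (Num.floor (beta * x))%:~R.

Definition recurrence_set beta psi : set R :=
  [set x | `[0, 1]%classic x /\
    infinite_set [set n : nat |
      (0 < n)%N /\ `|iter n (beta_map beta) x - x| < psi n]].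

Local Open Scope ereal_scope.

Definition parry_sum beta x : \bar R :=
  \sum_(0 <= n <oo | (x < iter n (beta_map beta) 1)%R) (beta ^- n)%:E.

Definition parry_mass beta : \bar R :=
  \int[lebesgue_measure]_(x in `[0%R, 1%R]) parry_sum beta x.

Definition parry_density beta x : \bar R :=
  (parry_mass beta)^-1 * parry_sum beta x.

(* A measure on the Borel sets of R, concentrated on the unit interval. *)
Definition parry_measure beta (A : set R) : \bar R :=
  \int[lebesgue_measure]_(x in A `&` `[0%R, 1%R]) parry_density beta x.

Section parry_probability.
Variable beta : R.
Hypothesis beta_gt1 : (1 < beta)%R.

Let term_ge0 n : 0 <= (beta ^- n)%:E.
Proof. by rewrite lee_fin invr_ge0 exprn_ge0// ltW// (lt_trans ltr01). Qed.

Let parry_sum_ge0 x : 0 <= parry_sum beta x.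
Proof. by apply: nneseries_ge0 => n _ _; exact: term_ge0. Qed.

Let parry_sumE : parry_sum beta = fun x => \sum_(0 <= n <oo)
  ((beta ^- n)%:E * (\1_`]-oo, iter n (beta_map beta) 1%R[ x)%:E).
Proof.
apply/funext => x; rewrite /parry_sum eseries_mkcond.
apply: eq_eseriesr => n _; rewrite indicE.
case: ifPn => xn.
  by rewrite mem_set ?mule1//= in_itv.
by rewrite memNset ?mule0//= in_itv/=; exact/negP.
Qed.

Let measurable_parry_sum (D : set R) : measurable_fun D (parry_sum beta).
Proof.
apply: measurable_funTS; rewrite parry_sumE.
apply: (@ge0_emeasurable_sum _ _ _ _
  (fun n x => (beta ^- n)%:E * (\1_`]-oo, iter n (beta_map beta) 1%R[ x)%:E)
  xpredT).
  by move=> n x _ _; apply: mule_ge0 => //; rewrite lee_fin indicE.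
move=> n _; apply: emeasurable_funM; first exact: measurable_cst.
exact/measurable_EFinP/measurable_indic.
Qed.

Let parry_sum_le x : parry_sum beta x <= (1 / (1 - beta^-1))%:E.
Proof.
apply: (@le_trans _ _ (\sum_(0 <= n <oo) (beta ^- n)%:E)).
  rewrite /parry_sum eseries_mkcond; apply: lee_nneseries => n _; case: ifP => //.
have b1 : (`|beta^-1| < 1)%R.
  by rewrite normfV invf_lt1 gtr0_norm// (lt_trans ltr01).
have := cvg_geometric_series (a := 1%R) b1 => cv.
rewrite -(cvg_lim _ cv)// -EFin_lim; last by apply/cvg_ex; eexists; exact: cv.
rewrite le_eqVlt; apply/orP; left; apply/eqP; congr (limn _).
apply/funext => n /=; rewrite /series/= sumEFin; congr EFin.
by apply: eq_bigr => i _; rewrite mul1r exprVn.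
Qed.

Lemma parry_mass_gt0 : 0 < parry_mass beta.
Proof.
have -> : parry_mass beta =
    \int[lebesgue_measure]_(x in `[0%R, 1%R[) parry_sum beta x.
  rewrite /parry_mass integral_itv_bndo_bndc//; exact: measurable_parry_sum.
apply: (@lt_le_trans _ _ (\int[lebesgue_measure]_(x in `[0%R, 1%R[) cst 1 x)).
  rewrite integral_cst//= mul1e lebesgue_measure_itv/= lte_fin ltr01.
  by rewrite oppr0 adde0 lte_fin ltr01.
apply: ge0_le_integral => //; first exact: measurable_parry_sum.
move=> x/=; rewrite in_itv/= => /andP[_ x1].
rewrite /parry_sum nneseries_recl; [|by move=> n _; exact: term_ge0|exact: x1].
by rewrite expr0 invr1 leeDl// nneseries_ge0.
Qed.

Lemma parry_mass_fin_num : parry_mass beta \is a fin_num.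
Proof.
rewrite ge0_fin_numE; last exact/ltW/parry_mass_gt0.
apply: (@le_lt_trans _ _ (\int[lebesgue_measure]_(x in `[0%R, 1%R])
    cst (1 / (1 - beta^-1))%:E x)).
  by apply: ge0_le_integral => //; first exact: measurable_parry_sum.
rewrite integral_cst//= lebesgue_measure_itv/= lte_fin ltr01.
by rewrite oppr0 adde0 -EFinM ltry.
Qed.

Let parry_density_ge0 x : 0 <= parry_density beta x.
Proof. by rewrite mule_ge0// inve_ge0 ltW// parry_mass_gt0. Qed.

Let measurable_parry_density (D : set R) : measurable_fun D (parry_density beta).
Proof.
by apply: emeasurable_funM; [exact: measurable_cst|exact: measurable_parry_sum].
Qed.

Let parry0 : parry_measure beta set0 = 0.
Proof. by rewrite /parry_measure set0I integral_set0. Qed.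

Let parry_ge0 A : 0 <= parry_measure beta A.
Proof. by apply: integral_ge0 => x _; exact: parry_density_ge0. Qed.

Let parry_sigma_additive : semi_sigma_additive (parry_measure beta).
Proof.
move=> /= F mF tF mUF; rewrite /parry_measure; apply: cvg_toP.
  apply: ereal_nondecreasing_is_cvgn => m n mn.
  apply: lee_sum_nneg_natr => // k _ _; apply: integral_ge0 => x _.
  exact: parry_density_ge0.
rewrite setI_bigcupl ge0_integral_bigcup//=.
- by move=> k; apply: measurableI; [exact: mF|exact: measurable_itv].
- exact: measurable_parry_density.
- exact: trivIset_setIr.
Qed.

HB.instance Definition _ := isMeasure.Build _ _ _
  (parry_measure beta) parry0 parry_ge0 parry_sigma_additive.

Let parry_setT : parry_measure beta [set: _] = 1.
Proof.
rewrite /parry_measure setTI /parry_density ge0_integralZl//.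
- rewrite mulVe ?gt_eqF ?parry_mass_gt0//.
  exact: parry_mass_fin_num.
- exact: measurable_parry_sum.
- by rewrite inve_ge0 ltW// parry_mass_gt0.
Qed.

HB.instance Definition _ :=
  @Measure_isProbability.Build _ _ R (parry_measure beta) parry_setT.

End parry_probability.
End beta_transformation.

(* Main.v *)
Require Import Defs.
From mathcomp Require Import all_boot all_order all_algebra finmap.
From mathcomp Require Import all_classical all_reals all_analysis.
From mathcomp Require Import measurable_realfun.
From mathcomp Require Import ring lra zify.

Import Order.TTheory GRing.Theory Num.Theory.
Import numFieldNormedType.Exports.

Set Implicit Arguments.
Unset Strict Implicit.
Unset Printing Implicit Defensive.

Local Open Scope classical_set_scope.
Local Open Scope ring_scope.

(** Why the dichotomy holds.

    The Parry measure is the integral of a Borel density against Lebesgue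
    measure on [0, 1], so it suffices to show that the recurrence set is
    Lebesgue-null when the series converges and that its complement in [0, 1] is
    Lebesgue-null when the series diverges ([parry_measure_null],
    [parry_measure_full]). Below, T is the beta-transformation.

    Everything rests on the full cylinders of order n: the intervals of length
    beta^-n that T^n maps affinely onto [0, 1). Those of a given order are
    pairwise disjoint, so there are at most beta^n of them, and every affine
    branch of T^n sits at the right end of a full cylinder of some order j <= n
    ([iterate_branch]). This holds because a branch that is not full has the
    largest admissible digits since it left its last full cylinder. Two counting
    facts follow: T^n has O(beta^n) branches, and the full cylinders of order n
    contained in a fixed interval fill a proportion of it that is bounded below
    by a constant depending only on beta once n is large ([full_inside_ge]).

    Convergence. On each branch T^n x - x is affine of slope beta^n - 1, so the
    points with |T^n x - x| < psi n lie in an interval of length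
    2 psi n / (beta^n - 1). Summing over the O(beta^n) branches gives a set of
    measure O(psi n) ([return_measure_le]), and the Borel-Cantelli lemma
    concludes.

    Divergence. With delta n = min(psi n, 1) / 2, every full cylinder of order n
    contains an interval of relative length delta n whose closure contains the
    fixed point of the affine extension of T^n ([target]), and all the points of
    this interval return at time n within psi n ([target_recur]). Let H_n be the union of these targets. In an
    interval J, and for large times, H_n has measure at least c delta_n |J|,
    while H_i and H_j are independent up to a constant factor and an error that
    decays exponentially in |i - j| ([hits_correlation_le]). The second moment
    method then gives the limsup set of the H_n a proportion of J bounded below
    by a constant that does not depend on J ([limsup_hits_ge]). A set with this
    property has positive lower density at every point of ]0, 1[, so by
    Lebesgue's density theorem its complement there is null
    ([limsup_hits_full]). *)

(** * Preliminaries on sets, measures and powers *)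

Lemma infinite_set_natP (A : set nat) :
  infinite_set A <-> forall n, exists2 k, (n <= k)%N & A k.
Proof.
split=> [infA n|HA /finite_seqP[s As]].
  apply: contrapT => H; apply: infA; apply: (sub_finite_set _ (finite_II n)).
  by move=> k Ak /=; rewrite ltnNge; apply/negP => nk; apply: H; exists k.
have [k sk] := HA (\max_(i <- s) i).+1; rewrite As /= => ks.
by have := leq_bigmax_seq (P := xpredT) (F := id) k ks isT; rewrite leqNgt sk.
Qed.

Lemma lebesgue_measure_itvco (R : realType) (a b : R) : a <= b ->
  lebesgue_measure `[a, b[ = (b - a)%:E.
Proof.
rewrite lebesgue_measure_itv/= le_eqVlt => /predU1P[->|ab].
  by rewrite lte_fin ltxx subrr.
by rewrite lte_fin ab.
Qed.

Lemma bernoulli_inequality (R : realDomainType) (h : R) n :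
  0 <= h -> 1 + n%:R * h <= (1 + h) ^+ n.
Proof.
move=> h0; elim: n => [|n IH]; first by rewrite mul0r addr0 expr0.
rewrite exprS -natr1; have : 0 <= n%:R * h * h by rewrite !mulr_ge0.
have : (1 + h) * (1 + n%:R * h) <= (1 + h) * (1 + h) ^+ n.
  by rewrite ler_wpM2l// addr_ge0.
lra.
Qed.

Section finite_families.
Local Open Scope ereal_scope.
Context {d : measure_display} {T : measurableType d} {R : realType}.
Variable mu : {measure set T -> \bar R}.

Lemma measure_seq_cover (I : choiceType) (s : seq I) (F : I -> set T) (D : set T) :
  measurable D -> (forall i, measurable (F i)) ->
  D `<=` \bigcup_(i in [set` s]) F i -> mu D <= \sum_(i <- s) mu (F i).
Proof.
move=> mD mF; rewrite bigcup_seq => DF.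
apply: (@le_trans _ _ (mu (\big[setU/set0]_(i <- s) F i))).
  by apply: le_measure; rewrite ?inE//; exact: bigsetU_measurable.
elim: s {DF} => [|i s IH]; first by rewrite !big_nil measure0.
rewrite !big_cons (le_trans (measureU2 _ _ _))//; first exact: bigsetU_measurable.
exact: leeD.
Qed.

Lemma measure_seq_packing (I : choiceType) (s : seq I) (F : I -> set T) (D : set T) :
  uniq s -> measurable D -> (forall i, measurable (F i)) ->
  (forall i, i \in s -> F i `<=` D) ->
  (forall i j x, i \in s -> j \in s -> F i x -> F j x -> i = j) ->
  \sum_(i <- s) mu (F i) <= mu D.
Proof.
move=> us mD mF FD Fdisj.
apply: (@le_trans _ _ (mu (\big[setU/set0]_(i <- s) F i))); last first.
  apply: le_measure; rewrite ?inE//; first exact: bigsetU_measurable.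
  by rewrite -bigcup_seq; exact: bigcup_sub.
elim: s us {FD} Fdisj => [|i s IH]; first by rewrite !big_nil measure0.
move=> /andP[iNs us] Fdisj; rewrite !big_cons.
rewrite measureU//; [|exact: bigsetU_measurable|].
  apply: leeD => //; apply: IH => // j k x js ks.
  by apply: Fdisj; rewrite in_cons ?js ?ks orbT.
rewrite -bigcup_seq -subset0 => x [Fix [j /= js Fjx]].
have ij : i = j by apply: (Fdisj _ _ x) => //; rewrite in_cons ?eqxx ?js ?orbT.
by rewrite ij js in iNs.
Qed.

(** Let X be the number of the sets [G i] that contain a given point. Since
    (t X - 1)^2 >= 0, the function 2 t X - t^2 X^2 is at most 1, and it vanishes
    where X = 0; it is thus bounded by the indicator of the union. Integrating
    gives the claim, in which the optimal [t], namely E X / E X^2, yields the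
    Chung-Erdos inequality. The squares are kept on the right so that no
    difference of extended reals occurs. *)
Lemma second_moment (I : choiceType) (s : seq I) (G : I -> set T) (t : R) :
  (0 <= t)%R -> (forall i, measurable (G i)) ->
  (2 * t)%:E * \sum_(i <- s) mu (G i) <= mu (\bigcup_(i in [set` s]) G i) +
    (t ^+ 2)%:E * \sum_(i <- s) \sum_(j <- s) mu (G i `&` G j).
Proof.
move=> t0 mG; set U := \bigcup_(i in _) _.
have mU : measurable U by rewrite /U bigcup_seq; exact: bigsetU_measurable.
have mI (A : set T) : measurable A ->
    measurable_fun [set: T] (fun x => (\1_A x)%:E : \bar R).
  by move=> mA; exact/measurable_EFinP/measurable_indic.
have I0 (A : set T) x : 0 <= (\1_A x)%:E :> \bar R by rewrite lee_fin indicE.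
have IE (A : set T) : measurable A -> mu A = \int[mu]_x (\1_A x)%:E.
  by move=> mA; rewrite integral_indic// setIT.
have t2 : 0 <= (2 * t)%:E by rewrite lee_fin mulr_ge0.
have tt : 0 <= (t ^+ 2)%:E by rewrite lee_fin sqr_ge0.
have mGG i j : measurable (G i `&` G j) by exact: measurableI.
rewrite (eq_bigr _ (fun i _ => IE _ (mG i))) -ge0_integral_sum//; last first.
  by move=> i; exact: mI.
rewrite -ge0_integralZl//; first last.
- by move=> x _; exact: sume_ge0.
- by apply: emeasurable_sum => i; exact: mI.
under [X in _ + _ * X]eq_bigr => i _.
  rewrite (eq_bigr _ (fun j _ => IE _ (mGG i j))) -ge0_integral_sum//; last first.
    by move=> j; exact: mI.
  over.
rewrite -ge0_integral_sum//; first last.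
- by move=> i x _; exact: sume_ge0.
- by move=> i; apply: emeasurable_sum => j; exact: mI.
have mS : measurable_fun [set: T]
    (fun x => \sum_(i <- s) \sum_(j <- s) (\1_(G i `&` G j) x)%:E : \bar R).
  by apply: emeasurable_sum => i; apply: emeasurable_sum => j; exact: mI.
have S0 x : 0 <= \sum_(i <- s) \sum_(j <- s) (\1_(G i `&` G j) x)%:E :> \bar R.
  by apply: sume_ge0 => i _; exact: sume_ge0.
rewrite -ge0_integralZl// IE// -ge0_integralD//; first last.
- by apply: emeasurable_funM => //; exact: measurable_cst.
- by move=> x _; exact: mule_ge0.
- exact: mI.
apply: ge0_le_integral => //.
- by move=> x _; rewrite mule_ge0// sume_ge0.
- apply: emeasurable_funM; first exact: measurable_cst.
  by apply: emeasurable_sum => i; exact: mI.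
- apply: emeasurable_funD; first exact: mI.
  by apply: emeasurable_funM => //; exact: measurable_cst.
move=> x _; under [X in _ + _ * X]eq_bigr do rewrite sumEFin.
rewrite !sumEFin -!EFinM -EFinD lee_fin.
set X := (\sum_(i <- s) \1_(G i) x)%R.
have -> : (\sum_(i <- s) \sum_(j <- s) \1_(G i `&` G j) x = X ^+ 2)%R.
  rewrite expr2 mulr_suml; apply: eq_bigr => i _.
  by rewrite mulr_sumr; apply: eq_bigr => j _; rewrite indicI.
have [xU|xU] := boolP (x \in U).
  rewrite [\1_U x]indicE xU /= mulr1n -exprMn.
  have := sqr_ge0 (t * X - 1)%R; rewrite sqrrB mulr1 expr1n; lra.
suff -> : X = 0%R by rewrite mulr0 expr0n mulr0 addr0 indicE.
apply: big1_seq => i /= si; rewrite indicE; case: (boolP (x \in G i)) => //.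
by rewrite inE => Gx; move: xU; rewrite notin_setE; case; exists i.
Qed.

End finite_families.

(** * Full cylinders and branches of the iterates *)

Section cylinders.
Context {R : realType}.
Variable beta : R.
Hypothesis beta_gt1 : 1 < beta.
Local Notation T := (beta_map beta).

Let beta_gt0 : 0 < beta.
Proof. exact: lt_trans ltr01 beta_gt1. Qed.

Lemma expN_gt0 n : 0 < beta ^- n.
Proof. by rewrite invr_gt0 exprn_gt0. Qed.

Lemma expN_ge0 n : 0 <= beta ^- n.
Proof. exact/ltW/expN_gt0. Qed.

Lemma mul_expN n : beta ^+ n * beta ^- n = 1.
Proof. by rewrite divff// gt_eqF// exprn_gt0. Qed.

Lemma expNS n : beta ^- n.+1 = beta ^- n / beta.
Proof. by rewrite exprS invfM mulrC. Qed.

Lemma expND m n : beta ^- (m + n) = beta ^- m * beta ^- n.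
Proof. by rewrite exprD invfM. Qed.

Lemma expN_le m n : (m <= n)%N -> beta ^- n <= beta ^- m.
Proof.
by move=> mn; rewrite lef_pV2 ?posrE ?exprn_gt0// ler_weXn2l// ltW.
Qed.

Lemma expN_le1 n : beta ^- n <= 1.
Proof. by have := expN_le (leq0n n); rewrite expr0 invr1. Qed.

Lemma beta_mapE (x : R) (e : int) : e%:~R <= beta * x < (e + 1)%:~R ->
  T x = beta * x - e%:~R.
Proof. by move=> /floor_def; rewrite /beta_map => ->. Qed.

(** Full cylinders are encoded by their left endpoint [a], so that no digit
    expansion has to be handled; [beta ^- n] is the length of the interval. *)
Definition full_cylinder n (a : R) : Prop :=
  [/\ 0 <= a, a + beta ^- n <= 1 &
    forall x, a <= x < a + beta ^- n -> iter n T x = beta ^+ n * (x - a)].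

Lemma full_cylinder0 : full_cylinder 0 0.
Proof. by split => [||x _]; rewrite ?expr0 ?invr1 ?add0r// subr0 mul1r. Qed.

(** Subdividing a full cylinder, its leftmost child corresponds to the digit 0,
    hence is full. *)
Lemma full_cylinderS n a : full_cylinder n a -> full_cylinder n.+1 a.
Proof.
move=> [a0 a1 aT]; have le := expN_le (leqnSn n); split => //.
  by apply: le_trans a1; rewrite lerD2l.
move=> x /andP[ax xa]; rewrite iterS aT; last first.
  by rewrite ax/= (lt_le_trans xa)// lerD2l.
rewrite (@beta_mapE _ 0) ?subr0 ?exprS ?mulrA// add0r -exprS.
apply/andP; split.
  by rewrite mulr_ge0 ?subr_ge0// exprn_ge0// ltW.
by rewrite mulrC -ltr_pdivlMr ?exprn_gt0// mul1r ltrBlDl.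
Qed.

Lemma full_cylinder_widen m n a : (m <= n)%N ->
  full_cylinder m a -> full_cylinder n a.
Proof.
move=> /subnK <-; elim: (n - m)%N => [//|k IH] /IH.
by rewrite addSn; exact: full_cylinderS.
Qed.

Lemma full_cylinder_inj n a b x : full_cylinder n a -> full_cylinder n b ->
  a <= x < a + beta ^- n -> b <= x < b + beta ^- n -> a = b.
Proof.
move=> [_ _ aT] [_ _ bT] xa xb; move: (aT _ xa); rewrite (bT _ xb).
by move/(mulfI (lt0r_neq0 (exprn_gt0 _ beta_gt0))) => /addrI /oppr_inj.
Qed.

Lemma full_cylinder_finite n : finite_set [set a | full_cylinder n a].
Proof.
pose f (a : R) := Num.trunc (beta ^+ n * a).
set A := [set a | _].
have injf : {in A &, injective f}; last first.
  rewrite -(eq_finite_set (inj_card_eq injf)).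
  apply: (@sub_finite_set _ _ `I_(Num.trunc (beta ^+ n)).+1) => //.
  move=> _ [a [a0 a1 _] <-]; rewrite /= ltnS; apply: le_truncn.
  by rewrite ler_piMr ?exprn_ge0 ?(ltW beta_gt0)//; have := expN_ge0 n; lra.
move=> a b; rewrite !inE /= => fa fb; rewrite /f => tab.
have pos x : full_cylinder n x -> 0 <= beta ^+ n * x.
  by case=> x0 _ _; rewrite mulr_ge0 ?exprn_ge0 ?(ltW beta_gt0).
have /andP[ta1 ta2] := truncn_itv (pos a fa).
have /andP[tb1 tb2] := truncn_itv (pos b fb).
rewrite tab in ta1 ta2; rewrite -natr1 in ta2 tb2.
have le c d : c <= d -> beta ^+ n * d < beta ^+ n * c + 1 -> d < c + beta ^- n.
  move=> _; rewrite -(mul_expN n) -mulrDr ltr_pM2l ?exprn_gt0//.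
have [ab|/ltW ba] := leP a b.
- apply: (@full_cylinder_inj n a b b) => //; first by rewrite ab le//; lra.
  by rewrite lexx ltrDl expN_gt0.
- apply: (@full_cylinder_inj n a b a) => //; last by rewrite ba le//; lra.
  by rewrite lexx ltrDl expN_gt0.
Qed.

Definition full_cylinders n : seq R := fset_set [set a | full_cylinder n a].

Lemma mem_full_cylinders n a : (a \in full_cylinders n) = `[< full_cylinder n a >].
Proof.
rewrite /full_cylinders in_fset_set; last exact: full_cylinder_finite.
by rewrite -[LHS]asboolb; apply: asbool_equiv_eq; rewrite inE.
Qed.

(** Induction on [n]. The branch through [x] ends at the right endpoint of a full
    cylinder of order [j], and T^n maps it onto [0, s). If the next digit [e] of
    [x] satisfies (e + 1) / beta <= s, then the points of the branch with this
    digit form a full cylinder of order n + 1, from which the description starts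
    again. Otherwise [e] is the largest digit on the branch, and the points with
    this digit keep the same right endpoint; their image is [0, beta s - e). *)
Lemma iterate_branch n (x : R) : 0 <= x < 1 -> exists j a s,
  [/\ (j <= n)%N, full_cylinder j a,
    [&& 0 < s, s <= 1 & s * beta ^- n <= beta ^- j],
    a + beta ^- j - s * beta ^- n <= x < a + beta ^- j &
    forall z, a + beta ^- j - s * beta ^- n <= z < a + beta ^- j ->
      iter n T z = beta ^+ n * (z - (a + beta ^- j)) + s].
Proof.
move=> x01; elim: n => [|n [j [a [s [jn fa s01 xr rT]]]]].
  exists 0%N, 0, 1; split => //; first exact: full_cylinder0.
  - by rewrite ltr01 lexx mul1r lexx.
  - by rewrite !expr0 invr1 mulr1 add0r subrr.
  - by move=> z _; rewrite !expr0 invr1 mul1r add0r /= subrK.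
set r := a + beta ^- j in xr rT *.
have bn0 := exprn_gt0 n beta_gt0.
have qE := mul_expN n; have q0 := expN_gt0 n.
have/and3P[s0 s1 sj] := s01; have /andP[rx xr'] := xr.
have ar : a <= r - s * beta ^- n by rewrite /r; lra.
set w := iter n T x.
have wE : w = beta ^+ n * (x - r) + s by rewrite /w rT// rx.
have w0 : 0 <= w.
  rewrite wE -(ler_pM2r q0) mul0r mulrDl mulrAC qE mul1r; lra.
have ws : w < s by rewrite wE gtrDr pmulr_rlt0// subr_lt0.
set e := Num.floor (beta * w).
have /andP[ew we] := floor_itv (beta * w); rewrite -/e in ew we.
have e0 : 0 <= (e%:~R : R) by rewrite ler0z /e floor_ge0 mulr_ge0// ltW.
have eD : (e + 1)%:~R = e%:~R + 1 :> R by rewrite intrD.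
have TE z : r - s * beta ^- n <= z < r ->
   e%:~R <= beta * (beta ^+ n * (z - r) + s) < (e + 1)%:~R ->
   iter n.+1 T z = beta ^+ n.+1 * (z - r) + (beta * s - e%:~R).
  by move=> zr ze; rewrite iterS (rT _ zr) (beta_mapE ze) exprS; ring.
have scale z : beta * (beta ^+ n * (z - r) + s) = beta ^+ n.+1 * (z - r) + beta * s.
  by rewrite mulrDr mulrA -exprS.
have xE : x = r + (w - s) * beta ^- n.
  by rewrite wE addrK mulrAC qE mul1r addrC subrK.
have bb : beta * beta^-1 = 1 by rewrite divff// gt_eqF.
have qSE := mul_expN n.+1; have qS := expNS n; have qS0 := expN_gt0 n.+1.
have bqS : beta * beta ^- n.+1 = beta ^- n by rewrite qS mulrCA bb mulr1.
have bS0 := exprn_gt0 n.+1 beta_gt0.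
have [es|se] := leP ((e + 1)%:~R) (beta * s).
  (* c is the point of the branch where T^n takes the value e / beta. *)
  pose c := r - (beta * s - e%:~R) * beta ^- n.+1.
  have cq : c + beta ^- n.+1 <= r.
    rewrite /c -addrA gerDl -mulNr -[X in _ + X]mul1r -mulrDl pmulr_lle0//; lra.
  have rc : r - s * beta ^- n <= c.
    by rewrite /c -bqS mulrA (mulrC s) mulrBl opprB lerD2l lerDr mulr_ge0// ltW.
  have xc : c <= x < c + beta ^- n.+1.
    rewrite xE /c -bqS; apply/andP; split.
      rewrite lerD2l mulrA -mulNr ler_pM2r//; lra.
    have : (beta * w - e%:~R - 1) * beta ^- n.+1 < 0 by rewrite pmulr_llt0//; lra.
    lra.
  have cT z : c <= z < c + beta ^- n.+1 ->
      iter n.+1 T z = beta ^+ n.+1 * (z - c).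
    move=> /andP[cz zc].
    have h : 0 <= beta ^+ n.+1 * (z - c) < 1.
      rewrite (mulr_ge0 (ltW bS0)) ?subr_ge0//=.
      by rewrite -qSE ltr_pM2l// ltrBlDl.
    have E : beta ^+ n.+1 * (z - c) =
        beta ^+ n.+1 * (z - r) + (beta * s - e%:~R).
      rewrite /c opprB addrCA [in LHS]addrC mulrDr; congr +%R.
      by rewrite mulrCA qSE mulr1.
    rewrite E in h; rewrite E; apply: TE.
      by rewrite (le_trans rc)//= (lt_le_trans zc).
    by rewrite scale; lra.
  exists n.+1, c, 1; rewrite mul1r addrK; split => //.
  - split => //.
    + by case: fa => a0 _ _; exact: le_trans (le_trans a0 ar) rc.
    + by case: fa => _ a1 _; exact: le_trans cq a1.
  - by rewrite ltr01 !lexx.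
  - by move=> z zc; rewrite opprD addrA mulrDr mulrN qSE subrK cT.
(* No point of the branch has a digit larger than e. *)
have bws : beta * w < beta * s by rewrite ltr_pM2l.
have s'q : (beta * s - e%:~R) * beta ^- n.+1 <= s * beta ^- n.
  by rewrite -bqS mulrA (mulrC s) ler_pM2r//; lra.
exists j, a, (beta * s - e%:~R); rewrite -/r; split => //.
- by rewrite ltnW.
- by apply/and3P; split; lra.
- rewrite xr' andbT.
  by rewrite xE -bqS lerD2l mulrA -mulNr ler_pM2r//; lra.
- move=> z /andP[cz zr]; apply: TE; first by rewrite zr andbT; lra.
  rewrite scale; apply/andP; split.
    rewrite -lerBlDr -(ler_pM2r qS0) mulrAC qSE mul1r; lra.
  have : beta ^+ n.+1 * (z - r) < 0 by rewrite pmulr_rlt0// subr_lt0.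
  lra.
Qed.

End cylinders.

(** * Counting full cylinders inside an interval *)

Section counting.
Context {R : realType}.
Variable beta : R.
Hypothesis beta_gt1 : 1 < beta.
Local Notation mu := (@lebesgue_measure R).

Let beta_gt0 : 0 < beta.
Proof. exact: lt_trans ltr01 beta_gt1. Qed.

Definition full_inside n (u v : R) : seq R :=
  [seq a <- full_cylinders beta n | (u <= a) && (a + beta ^- n <= v)].

Lemma full_insideP n (u v a : R) : reflect
  [/\ full_cylinder beta n a, u <= a & a + beta ^- n <= v]
  (a \in full_inside n u v).
Proof.
rewrite mem_filter (mem_full_cylinders beta_gt1); apply: (iffP idP).
  by case/andP => /andP[? ?] /asboolP.
by case=> fa -> ->; exact/asboolP.
Qed.

Lemma full_inside_uniq n (u v : R) : uniq (full_inside n u v).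
Proof. by rewrite filter_uniq// fset_uniq. Qed.

(** The full cylinders of a given order are disjoint. *)
Lemma full_inside_size n (u v : R) : u <= v ->
  (size (full_inside n u v))%:R * beta ^- n <= v - u.
Proof.
move=> uv; rewrite -lee_fin -(lebesgue_measure_itvco uv).
apply: le_trans (@measure_seq_packing _ _ _ mu _ (full_inside n u v)
  (fun a => `[a, a + beta ^- n[%classic) _ _ _ _ _ _) => //.
- under eq_bigr.
    move=> a _; rewrite /= lebesgue_measure_itvco ?lerDl ?expN_ge0//.
    rewrite addrAC subrr add0r; over.
  by rewrite sumEFin lee_fin big_const_seq count_predT iter_addr_0 mulr_natl.
- exact: full_inside_uniq.
- move=> a /full_insideP[_ ua av] x /=; rewrite !in_itv/= => /andP[ax xa].
  by rewrite (le_trans ua)//= (lt_le_trans xa).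
- move=> a b x /full_insideP[fa _ _] /full_insideP[fb _ _] /=; rewrite !in_itv/=.
  exact: full_cylinder_inj.
Qed.

(** By [iterate_branch], each point of [u, v) is within beta^-n of the right
    endpoint of a full cylinder of order at most [n] containing it; this cylinder
    lies in the interval enlarged by its own length. *)
Lemma full_inside_cover n (u v : R) : 0 <= u -> u <= v -> v <= 1 ->
  v - u <= \sum_(0 <= j < n.+1)
    (size (full_inside j (u - beta ^- j) (v + beta ^- j)))%:R * beta ^- n.
Proof.
move=> u0 uv v1; rewrite -lee_fin -(lebesgue_measure_itvco uv).
pose s := [seq (j, a) | j <- index_iota 0 n.+1,
  a <- full_inside j (u - beta ^- j) (v + beta ^- j)].
pose F (ja : nat * R) :=
  `[ja.2 + beta ^- ja.1 - beta ^- n, ja.2 + beta ^- ja.1[%classic.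
apply: le_trans (@measure_seq_cover _ _ _ mu _ s F _ _ _ _) _ => //.
- by move=> i; exact: measurable_itv.
- move=> x /=; rewrite in_itv/= => /andP[ux xv].
  have [j [a [t [jn fa /and3P[t0 t1 tj] /andP[lx xr] _]]]] : exists j a s, _
    := @iterate_branch R beta beta_gt1 n x
         ltac:(by rewrite (le_trans u0)//= (lt_le_trans xv)).
  have := expN_gt0 beta_gt1 n => q0.
  have tq : t * beta ^- n <= beta ^- n by rewrite ler_piMl// ltW.
  exists (j, a) => /=; last by rewrite /F/= in_itv/= xr andbT; lra.
  apply/allpairsPdep; exists j, a; split => //.
    by rewrite mem_index_iota ltnS.
  by apply/full_insideP; split => //; lra.
- rewrite big_allpairs_dep/= -sumEFin; apply: lee_sum => j _.
  under eq_bigr.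
    move=> a _; rewrite /F/= lebesgue_measure_itvco ?gerDl ?oppr_le0 ?expN_ge0//.
    rewrite opprB addrC subrK; over.
  by rewrite sumEFin lee_fin big_const_seq count_predT iter_addr_0 mulr_natl.
Qed.

(** Bernoulli's inequality for the square root 1 + h of [beta] gives
    beta^n >= (n h)^2. *)
Lemma natr_expN_small (e : R) : 0 < e ->
  exists N, forall n, (N <= n)%N -> n%:R * beta ^- n <= e.
Proof.
move=> e0; pose h := Num.sqrt beta - 1.
have h0 : 0 < h by rewrite subr_gt0 -[ltLHS]sqrtr1 ltr_sqrt.
have := archi_boundP (ltW (divr_gt0 ltr01 (mulr_gt0 e0 (mulr_gt0 h0 h0)))).
set N := Num.bound _ => HN; exists N.+1 => n Nn.
have n0 : 0 < n%:R :> R by rewrite ltr0n (leq_trans _ Nn).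
rewrite ler_pdivrMr ?exprn_gt0//.
have -> : beta = (1 + h) ^+ 2 by rewrite addrC subrK sqr_sqrtr// ltW.
have : n%:R * h <= (1 + h) ^+ n by apply: le_trans (bernoulli_inequality n (ltW h0)); lra.
rewrite exprAC => nh.
apply: (@le_trans _ _ (e * (n%:R * h) ^+ 2)); last first.
  by rewrite ler_pM2l// lerXn2r ?nnegrE ?mulr_ge0 ?exprn_ge0//; lra.
have : 1 < n%:R * (e * (h * h)).
  rewrite -ltr_pdivrMr ?mulr_gt0//; apply: lt_le_trans HN _.
  by rewrite ler_nat ltnW.
move=> /ltW; rewrite -(ler_pM2l n0) mulr1 => /le_trans; apply.
by rewrite le_eqVlt; apply/orP; left; apply/eqP; ring.
Qed.

Lemma expN_small (e : R) : 0 < e -> exists N, forall n, (N <= n)%N -> beta ^- n <= e.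
Proof.
move=> /natr_expN_small[N HN]; exists N.+1 => n Nn.
apply: le_trans (HN n (ltnW Nn)); rewrite ler_peMl ?expN_ge0// ler1n.
exact: leq_ltn_trans Nn.
Qed.

Lemma sum_exp_le n : \sum_(0 <= j < n) beta ^+ j <= beta ^+ n / (beta - 1).
Proof.
rewrite ler_pdivlMr ?subr_gt0// mulrC big_mkord -subrX1; lra.
Qed.

(** In the covering of the middle half of [u, v) by [full_inside_cover], the
    terms with j < n - K contribute at most a small multiple of v - u, since
    there are at most about beta^j (v - u) + 2 cylinders of order [j]. The
    remaining K + 1 terms are each bounded by the term of order [n], because a
    full cylinder of order [j] contains the full cylinder of order [n] with the
    same left endpoint. *)
Lemma full_inside_ge : exists2 c : R, 0 < c & forall u v : R,
  0 <= u -> u < v -> v <= 1 -> exists N, forall n, (N <= n)%N ->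
    c * (v - u) <= (size (full_inside n u v))%:R * beta ^- n.
Proof.
have [K HK] : exists K, beta ^- K <= (beta - 1) / 4.
  have [|K HK] := @expN_small ((beta - 1) / 4); last by exists K; exact: HK.
  by rewrite divr_gt0// subr_gt0.
have K0 : 0 < 4 * K.+1%:R :> R by rewrite mulr_gt0.
(* Half of v - u has to be covered; the discarded terms account for at most a
   quarter of v - u, and the remaining quarter is shared by K + 1 orders. *)
exists (4 * K.+1%:R)^-1; first by rewrite invr_gt0.
move=> u v u0 uv v1; set l := v - u.
have l0 : 0 < l by rewrite subr_gt0.
have [N1 HN1] := @natr_expN_small (l / 16) ltac:(lra).
have [N2 HN2] := @expN_small (l / 4) ltac:(lra).
exists (N1 + (N2 + K))%N => n Nn.
rewrite mulrC ler_pdivrMr//.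
set S := (size (full_inside n u v))%:R.
have Kn : (K <= n)%N by lia.
pose u' := u + l / 4; pose v' := v - l / 4.
have := @full_inside_cover n u' v' ltac:(rewrite /u'; lra) ltac:(rewrite /u' /v' /l; lra)
  ltac:(rewrite /v'; lra).
rewrite (@big_cat_nat _ _ _ (n - K))//=; [|by rewrite (leq_trans (leq_subr _ _))].
set A := \sum_(0 <= j < n - K) _; set B := \sum_(n - K <= j < n.+1) _.
have HB : B <= K.+1%:R * (S * beta ^- n).
  have -> : K.+1%:R * (S * beta ^- n) = \sum_(n - K <= j < n.+1) S * beta ^- n.
    by rewrite sumr_const_nat -[in RHS]mulr_natl subSn ?leq_subr// subKn.
  rewrite /B; apply: ler_sum_nat => j /andP[nKj jn].
  rewrite ler_wpM2r ?expN_ge0// ler_nat.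
  apply: uniq_leq_size => [|a]; first exact: full_inside_uniq.
  have qj : beta ^- j <= l / 4 by apply: HN2; lia.
  have qn : beta ^- n <= beta ^- j by exact: expN_le.
  move=> /full_insideP[fa ua av]; apply/full_insideP; split.
  - exact: (@full_cylinder_widen _ _ _ j).
  - by move: ua; rewrite /u'; lra.
  - by move: av; rewrite /v'; lra.
have HA : A <= l / 8 + 2 * (n%:R * beta ^- n).
  apply: (@le_trans _ _ (\sum_(0 <= j < n - K)
      (l / 2 * beta ^+ j * beta ^- n + 2 * beta ^- n))).
    apply: ler_sum => j _; rewrite -mulrDl ler_wpM2r ?expN_ge0//.
    have q0 := expN_gt0 beta_gt1 j.
    have := @full_inside_size j (u' - beta ^- j) (v' + beta ^- j)
      ltac:(rewrite /u' /v' /l; lra).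
    have -> : v' + beta ^- j - (u' - beta ^- j) = (l / 2 * beta ^+ j + 2) * beta ^- j.
      by rewrite mulrDl -mulrA mul_expN// /u' /v' /l; lra.
    by rewrite ler_pM2r.
  rewrite big_split/= -mulr_suml -mulr_sumr sumr_const_nat subn0; apply: lerD.
    apply: (@le_trans _ _ (l / 2 * (beta ^+ (n - K) / (beta - 1)) * beta ^- n)).
      by rewrite ler_wpM2r ?expN_ge0// ler_wpM2l ?sum_exp_le//; lra.
    have -> : l / 2 * (beta ^+ (n - K) / (beta - 1)) * beta ^- n =
        l / 2 * (beta ^- K / (beta - 1)).
      rewrite -mulrA; congr (_ * _); rewrite mulrAC; congr (_ / _).
      by rewrite -{2}(subnK Kn) expND mulrA mul_expN// mul1r.
    have : beta ^- K / (beta - 1) <= 1 / 4.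
      rewrite ler_pdivrMr ?subr_gt0//; lra.
    move=> /(ler_wpM2l (_ : 0 <= l / 2)); lra.
  rewrite -[leLHS]mulr_natl mulrCA ler_wpM2l// ler_wpM2r ?expN_ge0//.
  by rewrite ler_nat leq_subr.
have := HN1 n ltac:(lia); move: HA HB.
rewrite /u' /v' -/l => HA HB Hn H.
have : l / 4 <= K.+1%:R * (S * beta ^- n) by have lE : l = v - u by []; lra.
lra.
Qed.

End counting.

(** * Targets around the periodic points of full cylinders *)

Section targets.
Context {R : realType}.
Variable beta : R.
Hypothesis beta_gt1 : 1 < beta.
Local Notation T := (beta_map beta).
Local Notation mu := (@lebesgue_measure R).

Let beta_gt0 : 0 < beta.
Proof. exact: lt_trans ltr01 beta_gt1. Qed.

(** On a full cylinder with left endpoint [a], the affine map that extends T^n to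
    the closure has the fixed point a + p beta^-n, where p = a / (1 - beta^-n) is
    in [0, 1]. The target is the set of points of the cylinder whose image under T^n lies in the interval of length
    [e] starting at p (1 - e): this interval contains [p] or ends at it, and
    unlike the centred one it never leaves [0, 1]. *)
Definition target_left n (e a : R) : R :=
  a + a / (1 - beta ^- n) * (1 - e) * beta ^- n.

Definition target n (e a : R) : set R :=
  `[target_left n e a, target_left n e a + e * beta ^- n[%classic.

Lemma expN_lt1 n : (0 < n)%N -> beta ^- n < 1.
Proof. by move=> n0; rewrite invf_lt1 ?exprn_gt0// exprn_egt1 -?lt0n. Qed.

Lemma target_fixpoint n (a : R) : (0 < n)%N -> full_cylinder beta n a ->
  0 <= a / (1 - beta ^- n) <= 1.
Proof.
move=> n0 [a0 a1 _]; have q1 := expN_lt1 n0.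
rewrite divr_ge0//= ?ler_pdivrMr; lra.
Qed.

Lemma target_sub n (e a : R) : (0 < n)%N -> 0 <= e <= 1 ->
  full_cylinder beta n a ->
  [/\ a <= target_left n e a, target_left n e a + e * beta ^- n <= a + beta ^- n &
    target n e a `<=` `[a, a + beta ^- n[].
Proof.
move=> n0 /andP[e0 e1] fa; have /andP[p0 p1] := target_fixpoint n0 fa.
have q0 := expN_gt0 beta_gt1 n.
have h1 : a <= target_left n e a.
  by rewrite lerDl mulr_ge0 ?(ltW q0)// mulr_ge0// subr_ge0.
have h2 : target_left n e a + e * beta ^- n <= a + beta ^- n.
  rewrite /target_left -addrA lerD2l -mulrDl ler_piMl ?(ltW q0)//.
  have : a / (1 - beta ^- n) * (1 - e) <= 1 - e by rewrite ler_piMl// subr_ge0.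
  lra.
split => // x; rewrite /target /= !in_itv/= => /andP[lx xr].
by rewrite (le_trans h1)//= (lt_le_trans xr).
Qed.

(** If w = T^n x, then w - x = (w - p) (1 - beta^-n), and both [w] and [p] lie in
    the closure of the same interval of length [e]. *)
Lemma target_recur n (e psi a x : R) : (0 < n)%N -> 0 <= e <= 1 -> e < psi ->
  full_cylinder beta n a -> target n e a x -> `|iter n T x - x| < psi.
Proof.
move=> n0 e01 epsi fa tx; have /andP[e0 e1] := e01.
have [_ _ /(_ _ tx)] := target_sub n0 e01 fa; rewrite /= in_itv/= => xa.
have /andP[p0 p1] := target_fixpoint n0 fa.
have q0 := expN_gt0 beta_gt1 n; have q1 := expN_lt1 n0.
case: (fa) => _ _ /(_ _ xa) ->; set w := beta ^+ n * (x - a).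
have xE : x = a + w * beta ^- n.
  by rewrite /w mulrAC (mul_expN beta_gt1) mul1r addrC subrK.
have aE : a = a / (1 - beta ^- n) * (1 - beta ^- n) by rewrite divfK// gt_eqF// subr_gt0.
move: tx; rewrite /target /target_left /= in_itv/= {1 2}xE.
move: (a / _) aE p0 p1 => p aE p0 p1.
rewrite lerD2l ler_pM2r// -addrA ltrD2l -mulrDl ltr_pM2r// => /andP[w1 w2].
have -> : w - x = (w - p) * (1 - beta ^- n) by rewrite xE {1}aE; ring.
have pe : p * e <= e by rewrite ler_piMl.
have pe0 : 0 <= p * e by rewrite mulr_ge0.
apply: le_lt_trans epsi; rewrite normrM (ger0_norm (_ : 0 <= 1 - beta ^- n)); last lra.
apply: (@le_trans _ _ `|w - p|); first by rewrite ler_piMr//; lra.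
by rewrite ler_norml; apply/andP; split; lra.
Qed.

Section hits.
Variable delta : nat -> R.
Hypothesis delta01 : forall n, 0 <= delta n <= 1.

Let delta0 n : 0 <= delta n.
Proof. by have /andP[] := delta01 n. Qed.

Definition hits n : set R :=
  \bigcup_(a in [set` full_cylinders beta n]) target n (delta n) a.

Lemma measurable_hits n : measurable (hits n).
Proof.
by rewrite /hits bigcup_seq; apply: bigsetU_measurable => a _; exact: measurable_itv.
Qed.

Lemma hitsP n x : hits n x ->
  exists2 a, full_cylinder beta n a & target n (delta n) a x.
Proof. by case=> a /=; rewrite (mem_full_cylinders beta_gt1) => /asboolP; exists a. Qed.

Lemma target_measure n (e a : R) : 0 <= e -> mu (target n e a) = (e * beta ^- n)%:E.
Proof.
move=> e0; rewrite lebesgue_measure_itvco; first by rewrite addrAC subrr add0r.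
by rewrite lerDl mulr_ge0// expN_ge0.
Qed.

Lemma hits_inside n (u v x : R) : (0 < n)%N -> hits n x -> u <= x < v ->
  exists2 a, a \in full_inside beta n (u - beta ^- n) (v + beta ^- n) &
    target n (delta n) a x.
Proof.
move=> n0 /hitsP[a fa tx] /andP[ux xv]; exists a => //.
have [_ _ /(_ _ tx)] := target_sub n0 (delta01 n) fa; rewrite /= in_itv/= => /andP[ax xa].
by apply/(full_insideP beta_gt1); split => //; lra.
Qed.

Lemma hits_cap_le n (u v : R) : (0 < n)%N -> u <= v ->
  (mu (hits n `&` `[u, v[) <= (delta n * (v - u + 2 * beta ^- n))%:E)%E.
Proof.
move=> n0 uv; have q0 := expN_gt0 beta_gt1 n.
apply: le_trans (@measure_seq_cover _ _ _ mu _
  (full_inside beta n (u - beta ^- n) (v + beta ^- n)) (target n (delta n)) _ _ _ _) _.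
- by apply: measurableI; [exact: measurable_hits|exact: measurable_itv].
- by move=> a; exact: measurable_itv.
- by move=> x [hx]; rewrite /= in_itv/= => /(hits_inside n0 hx).
under eq_bigr do rewrite /= target_measure//.
rewrite sumEFin lee_fin big_const_seq count_predT iter_addr_0 -[leLHS]mulr_natr.
rewrite -mulrA ler_wpM2l// mulrC.
apply: le_trans (full_inside_size beta_gt1 n _) _; first by lra.
lra.
Qed.

Lemma hits_cap_ge : exists2 c : R, 0 < c & forall u v : R,
  0 <= u -> u < v -> v <= 1 -> exists N, forall n, (N <= n)%N ->
    ((c * (v - u) * delta n)%:E <= mu (hits n `&` `[u, v[))%E.
Proof.
have [c c0 Hc] := full_inside_ge beta_gt1; exists c => // u v u0 uv v1.
have [N HN] := Hc _ _ u0 uv v1; exists N.+1 => n Nn.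
have n0 : (0 < n)%N by exact: leq_trans Nn.
apply: le_trans (@measure_seq_packing _ _ _ mu _
  (full_inside beta n u v) (target n (delta n)) _ _ _ _ _ _).
- under eq_bigr do rewrite /= target_measure//.
  rewrite sumEFin lee_fin big_const_seq count_predT iter_addr_0 -[leRHS]mulr_natr.
  by rewrite -[leRHS]mulrA [leLHS]mulrC ler_wpM2l// [leRHS]mulrC HN// ltnW.
- exact: full_inside_uniq.
- by apply: measurableI; [exact: measurable_hits|exact: measurable_itv].
- by move=> a; exact: measurable_itv.
- move=> a /(full_insideP beta_gt1)[fa ua av] x tx; split.
    by exists a => //=; rewrite (mem_full_cylinders beta_gt1); exact/asboolP.
  have [_ _ /(_ _ tx)] := target_sub n0 (delta01 n) fa; rewrite /= !in_itv/=.
  by move=> /andP[ax xa]; apply/andP; split; lra.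
- move=> a b x /(full_insideP beta_gt1)[fa _ _] /(full_insideP beta_gt1)[fb _ _] ta tb.
  have [_ _ /(_ _ ta)] := target_sub n0 (delta01 n) fa; rewrite /= in_itv/= => xa.
  have [_ _ /(_ _ tb)] := target_sub n0 (delta01 n) fb; rewrite /= in_itv/= => xb.
  exact: full_cylinder_inj fa fb xa xb.
Qed.

(** Inside each target of order [m], an interval of length delta m beta^-m, the
    targets of order [n] occupy the proportion [delta n], up to the two cylinders
    of order [n] that can stick out at the ends. This boundary effect, summed
    over the at most beta^m (v - u) + 2 targets of order [m], is the
    term that decays exponentially in n - m. *)
Lemma hits_pair_le m n (u v : R) : (0 < m < n)%N -> u <= v ->
  (mu (hits m `&` hits n `&` `[u, v[) <=
    ((v - u + 2 * beta ^- m) *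
      (delta m * delta n + 2 * delta n * beta ^- (n - m)))%:E)%E.
Proof.
move=> /andP[m0 mn] uv; have n0 : (0 < n)%N by exact: leq_ltn_trans mn.
have q0 := expN_gt0 beta_gt1 m; have p0 := expN_gt0 beta_gt1 n.
pose s := full_inside beta m (u - beta ^- m) (v + beta ^- m).
apply: le_trans (@measure_seq_cover _ _ _ mu _ s
  (fun a => hits n `&` target m (delta m) a) _ _ _ _) _.
- apply: measurableI; last exact: measurable_itv.
  by apply: measurableI; exact: measurable_hits.
- by move=> a; apply: measurableI; [exact: measurable_hits|exact: measurable_itv].
- move=> x [[hm hn]]; rewrite /= in_itv/= => /(hits_inside m0 hm)[a sa ta].
  by exists a.
have le a : (mu (hits n `&` target m (delta m) a) <=
    (delta n * (delta m * beta ^- m + 2 * beta ^- n))%:E)%E.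
  apply: le_trans (hits_cap_le n0 _) _; first by rewrite lerDl mulr_ge0// ltW.
  by rewrite (addrAC (target_left _ _ _)) subrr add0r.
apply: le_trans (lee_sum _ (fun a _ => le a)) _.
rewrite sumEFin lee_fin big_const_seq count_predT iter_addr_0 -[leLHS]mulr_natr.
have -> : delta n * (delta m * beta ^- m + 2 * beta ^- n) =
    beta ^- m * (delta m * delta n + 2 * delta n * beta ^- (n - m)).
  have -> : beta ^- n = beta ^- m * beta ^- (n - m) by rewrite -expND subnKC// ltnW.
  by move: (beta ^- m) (beta ^- _) => x y; ring.
rewrite mulrAC ler_wpM2r//; first by rewrite addr_ge0// !mulr_ge0// expN_ge0.
rewrite mulrC; apply: le_trans (full_inside_size beta_gt1 m _) _; first by lra.
lra.
Qed.

End hits.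
End targets.

(** * The limsup set of the targets has full measure *)

Section limsup.
Context {R : realType}.
Variable beta : R.
Hypothesis beta_gt1 : 1 < beta.
Local Notation mu := (@lebesgue_measure R).

Let beta_gt0 : 0 < beta.
Proof. exact: lt_trans ltr01 beta_gt1. Qed.

(** beta^-|i - j|, one of the two truncated subtractions being zero. *)
Definition decay i j : R := beta ^- (i - j) * beta ^- (j - i).

Lemma decayC i j : decay i j = decay j i.
Proof. exact: mulrC. Qed.

Lemma decay_ge0 i j : 0 <= decay i j.
Proof. by rewrite mulr_ge0 ?expN_ge0. Qed.

(** The bound is the sum of the two-sided geometric series. *)
Lemma sum_decay_le i m n :
  \sum_(m <= j < n) decay i j <= (beta + 1) / (beta - 1).
Proof.
have b1 : 0 < beta - 1 by rewrite subr_gt0.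
have step k : beta ^- k.+1 * beta = beta ^- k.
  by rewrite expNS mulfVK// gt_eqF.
have H N : (\sum_(0 <= j < N) decay i j) * (beta - 1) <=
    if (N <= i)%N then beta ^- (i - N) else beta + 1 - beta ^- (N - i.+1).
  elim: N => [|N]; first by rewrite big_geq// mul0r leq0n expN_ge0.
  rewrite big_nat_recr//= mulrDl.
  have [Ni|Ni|->] := ltngtP N i.
  - have -> : decay i N = beta ^- (i - N).
      by rewrite /decay (eqP (ltnW Ni : _ - _ == 0)%N) expr0 invr1 mulr1.
    by have := step (i - N.+1)%N; rewrite -subSn// subSS; lra.
  - have -> : decay i N = beta ^- (N - i).
      by rewrite /decay (eqP (ltnW Ni : _ - _ == 0)%N) expr0 invr1 mul1r.
    have := step (N - i.+1)%N; rewrite -subSn// subSS; lra.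
  - rewrite !subnn /decay subnn expr0 invr1 mulr1; lra.
have Hn N : \sum_(0 <= j < N) decay i j <= (beta + 1) / (beta - 1).
  rewrite ler_pdivlMr//; apply: le_trans (H N) _; case: ifP => _.
    by have := expN_le1 beta_gt1 (i - N); lra.
  by have := expN_ge0 beta_gt1 (N - i.+1); lra.
have [mn|nm] := leqP m n; last first.
  by rewrite big_geq ?(ltnW nm)// divr_ge0// ?ltW//; lra.
apply: le_trans (Hn n); rewrite [leRHS](@big_cat_nat _ _ _ m)//= lerDr.
by apply: sumr_ge0 => j _; exact: decay_ge0.
Qed.

Variable delta : nat -> R.
Hypothesis delta01 : forall n, 0 <= delta n <= 1.
Hypothesis delta_div :
  forall m, exists n, 1 / 2 <= \sum_(m <= i < n) delta i.

Let delta0 n : 0 <= delta n.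
Proof. by have /andP[] := delta01 n. Qed.

Local Notation hits := (hits beta delta).

(** A bound symmetric in [i] and [j] that also covers the diagonal, so that it
    can be summed over a square of indices. *)
Lemma hits_correlation_le i j (u v : R) : (0 < i)%N -> (0 < j)%N -> u <= v ->
  2 * beta ^- i <= v - u -> 2 * beta ^- j <= v - u ->
  (mu (hits i `&` `[u, v[ `&` (hits j `&` `[u, v[)) <=
    (2 * (v - u) *
      (delta i * delta j + 2 * (delta i + delta j) * decay i j))%:E)%E.
Proof.
move=> i0 j0 uv qi qj; rewrite setIACA setIid.
have uv0 : 0 <= v - u by rewrite subr_ge0.
have di := delta0 i; have dj := delta0 j.
have dominate (a b D : R) : 0 <= a -> 0 <= b -> 0 <= D -> forall q : R, 2 * q <= v - u ->
    (v - u + 2 * q) * (a * b + 2 * b * D) <= 2 * (v - u) * (a * b + 2 * (a + b) * D).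
  move=> a0 b0 D0 q Hq; apply: (@le_trans _ _ (2 * (v - u) * (a * b + 2 * b * D))).
    by rewrite ler_wpM2r// ?addr_ge0// ?mulr_ge0//; lra.
  by rewrite ler_wpM2l// ?mulr_ge0// lerD2l ler_wpM2r//; lra.
have [ij|ji|eij] := ltngtP i j.
- apply: le_trans (hits_pair_le beta_gt1 delta01 _ uv) _; first by rewrite i0.
  rewrite lee_fin /decay (eqP (ltnW ij : _ - _ == 0)%N) expr0 invr1 mul1r.
  by apply: dominate => //; rewrite expN_ge0.
- rewrite (setIC (hits i)).
  apply: le_trans (hits_pair_le beta_gt1 delta01 _ uv) _; first by rewrite j0.
  rewrite lee_fin /decay (eqP (ltnW ji : _ - _ == 0)%N) expr0 invr1 mulr1.
  rewrite (addrC (delta i)) (mulrC (delta i)).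
  by apply: dominate => //; rewrite expN_ge0.
- rewrite -eij setIid; apply: le_trans (hits_cap_le beta_gt1 delta01 i0 uv) _.
  rewrite lee_fin /decay subnn expr0 invr1 !mulr1.
  have : 0 <= (v - u) * (delta i * delta i) by rewrite !mulr_ge0.
  have : delta i * (2 * beta ^- i) <= delta i * (v - u) by rewrite ler_wpM2l.
  have : 0 <= (v - u) * delta i by rewrite mulr_ge0.
  lra.
Qed.

(** The second moment method, applied to the times in a window [n, N) over which
    [delta] has sum S >= 1/2: the first moment is at least c L S, and the second
    at most C L S^2, where the linear terms in [S] are absorbed using
    S <= 2 S^2. The resulting bound does not depend on the window, and it passes
    to the limit as [n] tends to infinity. *)
Lemma limsup_hits_ge : exists2 k : R, 0 < k & forall u v : R,
  0 <= u -> u < v -> v <= 1 ->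
  ((k * (v - u))%:E <= mu (lim_sup_set hits `&` `[u, v[))%E.
Proof.
have [c c0 Hc] := hits_cap_ge beta_gt1 delta01.
pose M := (beta + 1) / (beta - 1).
have M0 : 0 < M by rewrite divr_gt0// ?subr_gt0// addr_gt0.
pose C := 2 * (1 + 8 * M); have C0 : 0 < C by rewrite /C; lra.
exists (c ^+ 2 / C); first by rewrite divr_gt0// exprn_gt0.
move=> u v u0 uv v1; set L := v - u; have L0 : 0 < L by rewrite subr_gt0.
have [N1 HN1] := Hc _ _ u0 uv v1.
have [N2 HN2] := @expN_small _ _ beta_gt1 (L / 2) ltac:(lra).
pose G n := hits n `&` `[u, v[.
have mG n : measurable (G n).
  by apply: measurableI; [exact: measurable_hits|exact: measurable_itv].
have mbG n : measurable (\bigcup_(k >= n) G k) by exact: bigcup_measurable.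
have key n : (N1 + N2 < n)%N -> ((c ^+ 2 / C * L)%:E <= mu (\bigcup_(k >= n) G k))%E.
  move=> Nn; have [N HN] := delta_div n.
  set S := \sum_(n <= i < N) delta i in HN.
  have S0 : 0 < S by lra.
  (* the ratio of the bounds for the first and the second moment *)
  pose t := c / (C * S); have t0 : 0 < t by rewrite divr_gt0// mulr_gt0.
  pose s := index_iota n N.
  have pos i : (n <= i)%N -> (0 < i)%N.
    by move=> ni; exact: leq_ltn_trans (leq0n _) (leq_trans Nn ni).
  have small i : (n <= i)%N -> 2 * beta ^- i <= v - u.
    move=> ni; have : beta ^- i <= L / 2.
      by apply: HN2; exact: leq_trans (leq_addl N1 N2) (ltnW (leq_trans Nn ni)).
    by rewrite /L; lra.
  have lower : ((c * L * S)%:E <= \sum_(i <- s) mu (G i))%E.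
    rewrite mulr_sumr -sumEFin big_seq [leRHS]big_seq; apply: lee_sum => i.
    rewrite mem_index_iota => /andP[ni _]; apply: HN1.
    exact: leq_trans (leq_addr N2 N1) (ltnW (leq_trans Nn ni)).
  have upper : (\sum_(i <- s) \sum_(j <- s) mu (G i `&` G j) <= (C * L * S ^+ 2)%:E)%E.
    apply: (@le_trans _ _ (\sum_(i <- s) \sum_(j <- s) (2 * L *
      (delta i * delta j + 2 * (delta i + delta j) * decay i j))%:E)%E).
      rewrite big_seq [leRHS]big_seq; apply: lee_sum => i.
      rewrite mem_index_iota => /andP[ni _].
      rewrite big_seq [leRHS]big_seq; apply: lee_sum => j.
      rewrite mem_index_iota => /andP[nj _].
      exact: (hits_correlation_le (pos _ ni) (pos _ nj) (ltW uv)
        (small _ ni) (small _ nj)).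
    under eq_bigr do rewrite sumEFin; rewrite sumEFin lee_fin.
    under eq_bigr do rewrite -mulr_sumr; rewrite -mulr_sumr.
    have -> : C * L * S ^+ 2 = 2 * L * ((1 + 8 * M) * S ^+ 2) by rewrite /C; ring.
    rewrite ler_wpM2l//; first lra.
    have sumD : \sum_(i <- s) \sum_(j <- s) delta i * decay i j <= S * M.
      rewrite mulr_suml; apply: ler_sum => i _; rewrite -mulr_sumr ler_wpM2l//.
      exact: sum_decay_le.
    apply: (@le_trans _ _ (S ^+ 2 + 4 * (S * M))); last first.
      have : 0 <= S * M * (S - 1 / 2) by apply: mulr_ge0; [rewrite mulr_ge0// ltW|lra].
      lra.
    have -> : \sum_(i <- s) \sum_(j <- s)
        (delta i * delta j + 2 * (delta i + delta j) * decay i j) =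
      S ^+ 2 + 2 * (\sum_(i <- s) \sum_(j <- s) delta i * decay i j +
                    \sum_(i <- s) \sum_(j <- s) delta j * decay i j).
      rewrite expr2 mulr_suml -big_split/= mulr_sumr -big_split/=.
      apply: eq_bigr => i _; rewrite mulr_sumr -big_split/= mulr_sumr -big_split/=.
      by apply: eq_bigr => j _; ring.
    have -> : \sum_(i <- s) \sum_(j <- s) delta j * decay i j =
        \sum_(i <- s) \sum_(j <- s) delta i * decay i j.
      rewrite exchange_big/=; apply: eq_bigr => i _; apply: eq_bigr => j _.
      by rewrite decayC.
    lra.
  have : ((2 * t * (c * L * S))%:E <= mu (\bigcup_(i in [set` s]) G i) +
      (t ^+ 2 * (C * L * S ^+ 2))%:E)%E.
    apply: le_trans (le_trans (second_moment mu s (ltW t0) mG) _).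
      by rewrite EFinM lee_wpmul2l// lee_fin mulr_ge0 ?ltW.
    by rewrite leeD2l// (EFinM (t ^+ 2)) lee_wpmul2l// lee_fin sqr_ge0.
  rewrite -leeBlDr// -EFinB.
  have -> : 2 * t * (c * L * S) - t ^+ 2 * (C * L * S ^+ 2) = c ^+ 2 / C * L.
    by rewrite /t; field; rewrite !gt_eqF.
  move=> /le_trans; apply; apply: le_measure; rewrite ?inE//.
  - by rewrite bigcup_seq; apply: bigsetU_measurable => i _; exact: mG.
  - exact: mbG.
  - by move=> x [i /=]; rewrite mem_index_iota => /andP[ni _] Gx; exists i.
have mls : measurable (lim_sup_set hits).
  apply: bigcap_measurable => // k _.
  by apply: bigcup_measurable => j _; exact: measurable_hits.
apply: (@le_trans _ _ (mu (lim_sup_set G))); last first.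
  apply: le_measure; rewrite ?inE//.
  - by apply: bigcap_measurable => // k _; exact: mbG.
  - by apply: measurableI => //; exact: measurable_itv.
  - move=> x Gx; split; last by have [k _ [_ +]] := Gx 0%N I.
    by move=> n nI; have [k nk [hk _]] := Gx n nI; exists k.
(* continuity from above needs a set of finite measure *)
have fin : (mu (\bigcup_(k >= 0%N) G k) < +oo)%E.
  apply: (@le_lt_trans _ _ (mu `[u, v[)); last first.
    by rewrite lebesgue_measure_itvco ?ltry ?ltW.
  apply: le_measure; rewrite ?inE//; first exact: mbG.
  by apply: bigcup_sub => k _ x [].
have cv := lim_sup_set_cvg mu G mG fin.
rewrite -(cvg_lim _ cv)//; apply: lime_ge; first by apply/cvg_ex; eexists; exact: cv.
exists (N1 + N2).+1 => // n /= Nn; exact: key.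
Qed.

(** A density point of the complement of the limsup set in ]0, 1[ would
    contradict [limsup_hits_ge] on short intervals around it. *)
Lemma limsup_hits_full : mu (`]0, 1[ `\` lim_sup_set hits) = 0%E.
Proof.
have [k k0 Hk] := limsup_hits_ge; set A := lim_sup_set hits.
have mA : measurable A.
  apply: bigcap_measurable => // n _.
  by apply: bigcup_measurable => j _; exact: measurable_hits.
have : mu.-negligible (`]0, 1[ `\` A).
  have := lebesgue_density mA; apply: negligibleS => x /= [].
  rewrite in_itv/= => /andP[x0 x1] xA H.
  have A0 : \1_A x = 0 :> R by rewrite indicE memNset.
  rewrite A0 in H.
  suff : ((k / 2)%:E <= (0 : R)%:E)%E by rewrite lee_fin leNgt divr_gt0.
  apply: cvge_ge H; near=> r.
  have r0 : 0 < r by near: r; exact: nbhs_right_gt.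
  have : r < Num.min x (1 - x).
    by near: r; apply: nbhs_right_lt; rewrite lt_min x0 subr_gt0.
  rewrite lt_min => /andP[rx rx1]; rewrite lebesgue_measure_ball ?(ltW r0)//.
  have := Hk (x - r / 2) (x + r / 2) ltac:(lra) ltac:(lra) ltac:(lra).
  have -> : x + r / 2 - (x - r / 2) = r by lra.
  move=> kr.
  have : (mu (A `&` `[(x - r / 2)%R, (x + r / 2)%R[) <= mu (A `&` ball x r))%E.
    apply: le_measure; rewrite ?inE//.
    - by apply: measurableI => //; exact: measurable_itv.
    - by apply: measurableI => //; exact: measurable_ball.
    - apply: setIS => y; rewrite /= in_itv/= => /andP[y1 y2].
      by rewrite /ball/= ltr_distlC; apply/andP; split; lra.
  move=> /(le_trans kr) kr'.
  rewrite inver mulrn_eq0/= gt_eqF// lee_pdivlMr ?mulrn_wgt0//.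
  apply: le_trans kr'; rewrite -EFinM lee_fin -mulr_natr; lra.
move=> neg; apply: (measure_negligible _ neg).
by apply: measurableD => //; exact: measurable_itv.
Unshelve. all: by end_near. Qed.

End limsup.

(** * Measure of the set of points returning at a given time *)

Section convergence.
Context {R : realType}.
Variable beta : R.
Hypothesis beta_gt1 : 1 < beta.
Local Notation T := (beta_map beta).
Local Notation mu := (@lebesgue_measure R).

Let beta_gt0 : 0 < beta.
Proof. exact: lt_trans ltr01 beta_gt1. Qed.

(** [s] is the supremum of T^n over the branch ending at the right endpoint of the
    full cylinder of order [j] starting at [a]. *)
Definition branch_height n j (a s : R) : Prop := 0 < s /\
  forall z, a + beta ^- j - s * beta ^- n <= z < a + beta ^- j ->
    iter n T z = beta ^+ n * (z - (a + beta ^- j)) + s.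

(** Hence a full cylinder of order [j] carries at most one branch of T^n at its
    right end, and the branches of T^n can be counted by full cylinders. *)
Lemma branch_height_inj n j (a s t : R) :
  branch_height n j a s -> branch_height n j a t -> s = t.
Proof.
move=> [s0 sT] [t0 tT]; have q0 := expN_gt0 beta_gt1 n.
pose z := a + beta ^- j - Num.min s t * beta ^- n.
have m0 : 0 < Num.min s t by rewrite lt_min s0.
have zr : z < a + beta ^- j by rewrite gtrDl oppr_lt0 mulr_gt0.
have zs : a + beta ^- j - s * beta ^- n <= z.
  by rewrite lerD2l lerN2 ler_pM2r// ge_min lexx.
have zt : a + beta ^- j - t * beta ^- n <= z.
  by rewrite lerD2l lerN2 ler_pM2r// ge_min lexx orbT.
have := sT z; rewrite zs zr => /(_ isT); rewrite (tT z) ?zt//.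
by move=> /addrI.
Qed.

(** There are at most beta^0 + ... + beta^n <= beta^(n + 1) / (beta - 1) branches
    of T^n, and on each of them the points that return within [e] lie in an
    interval of length 2 e / (beta^n - 1). The constant comes from the
    inequality beta^n - 1 >= beta^n (beta - 1) / beta. *)
Lemma return_measure_le n (e : R) (A : set R) : (0 < n)%N -> 0 < e -> measurable A ->
  (forall x, A x -> 0 <= x < 1 /\ `|iter n T x - x| < e) ->
  (mu A <= (2 * (beta / (beta - 1)) ^+ 2 * e)%:E)%E.
Proof.
move=> n0 e0 mA HA; have b1 : 0 < beta - 1 by rewrite subr_gt0.
have B1 : 1 < beta ^+ n by rewrite exprn_egt1// -lt0n.
have Bn1 : 0 < beta ^+ n - 1 by rewrite subr_gt0.
pose w := e / (beta ^+ n - 1); have w0 : 0 < w by rewrite divr_gt0.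
(* y is the fixed point of the affine branch at the end of the cylinder ja. *)
pose h (ja : nat * R) : R := xget 0 [set s | branch_height n ja.1 ja.2 s].
pose y ja := (beta ^+ n * (ja.2 + beta ^- ja.1) - h ja) / (beta ^+ n - 1).
pose F ja := `[y ja - w, y ja + w[%classic.
pose s := [seq (j, a) | j <- index_iota 0 n.+1, a <- full_inside beta j 0 1].
apply: (le_trans (@measure_seq_cover _ _ _ mu _ s F A mA _ _)).
- by move=> ja; exact: measurable_itv.
- move=> x /HA[x01 xe].
  have [j [a [t [jn fa /and3P[t0 t1 tj] xr tT]]]] := iterate_branch beta_gt1 n x01.
  exists (j, a) => /=.
    apply/allpairsPdep; exists j, a; split => //.
      by rewrite mem_index_iota ltnS.
    by apply/(full_insideP beta_gt1); split => //; case: (fa).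
  have bt : branch_height n j a t by [].
  have ht : h (j, a) = t.
    exact: branch_height_inj (xgetPex 0 (ex_intro _ t bt)) bt.
  rewrite /F /= in_itv/=.
  have : `|x - y (j, a)| < w.
    rewrite /w ltr_pdivlMr// -[X in _ * X](gtr0_norm Bn1) -normrM.
    suff -> : (x - y (j, a)) * (beta ^+ n - 1) = iter n T x - x by [].
    rewrite tT// mulrBl /y divfK ?gt_eqF// ht /=.
    by move: (beta ^+ n) (beta ^- j) => b q; ring.
  by rewrite ltr_distl => /andP[/ltW -> ->].
rewrite big_allpairs_dep/=.
under eq_bigr => j _.
  under eq_bigr.
    move=> a _; rewrite /F lebesgue_measure_itvco; last by rewrite lerD2l; lra.
    over.
  over.
apply: (@le_trans _ _ (\sum_(j <- index_iota 0 n.+1) (beta ^+ j * (2 * w))%:E)%E).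
  apply: lee_sum => j _.
  apply: (@le_trans _ _ (\sum_(a <- full_inside beta j 0 1) (2 * w)%:E)%E).
    by apply: lee_sum => a _; rewrite lee_fin; lra.
  rewrite sumEFin lee_fin big_const_seq count_predT iter_addr_0 -[leLHS]mulr_natl.
  rewrite ler_wpM2r//; first by rewrite mulr_ge0// ltW.
  have := full_inside_size beta_gt1 j (ler01 : 0 <= (1 : R)).
  by rewrite subr0 ler_pdivrMr ?exprn_gt0// mul1r.
rewrite sumEFin lee_fin -mulr_suml.
apply: (@le_trans _ _ (beta ^+ n.+1 / (beta - 1) * (2 * w))).
  by rewrite ler_wpM2r ?sum_exp_le// mulr_ge0// ltW.
have -> : 2 * (beta / (beta - 1)) ^+ 2 * e =
    (beta / (beta - 1)) * (2 * e) * (beta / (beta - 1)) by field; rewrite gt_eqF.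
have -> : beta ^+ n.+1 / (beta - 1) * (2 * w) =
    (beta / (beta - 1)) * (2 * e) * (beta ^+ n / (beta ^+ n - 1)).
  by rewrite /w exprS; field; rewrite !gt_eqF.
rewrite ler_wpM2l//; first by rewrite mulr_ge0 ?divr_ge0 ?ltW// mulr_gt0.
rewrite ler_pdivrMr// mulrAC ler_pdivlMr//.
have : beta <= beta ^+ n by rewrite -[leLHS]expr1 ler_weXn2l// ltW.
lra.
Qed.

End convergence.

(** * The zero-one law *)

Section zero_one_law.
Context {R : realType}.
Variable beta : R.
Hypothesis beta_gt1 : 1 < beta.
Variable psi : nat -> R.
Hypothesis psi_gt0 : forall n, (0 < n)%N -> 0 < psi n.
Local Notation T := (beta_map beta).
Local Notation mu := (@lebesgue_measure R).

Let beta_gt0 : 0 < beta.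
Proof. exact: lt_trans ltr01 beta_gt1. Qed.

Lemma measurable_beta_map : measurable_fun [set: R] T.
Proof.
apply: measurable_funB; first exact: measurable_funM.
apply: nondecreasing_measurable => // x y xy.
by rewrite ler_int; apply: le_floor; rewrite ler_pM2l.
Qed.

Lemma measurable_iter_beta_map n : measurable_fun [set: R] (iter n T).
Proof.
elim: n => [|n IH]; first exact: measurable_id.
exact: (measurableT_comp measurable_beta_map IH).
Qed.

Definition near_return n : set R :=
  [set x | (0 < n)%N /\ `|iter n T x - x| < psi n].

Lemma measurable_near_return n : measurable (near_return n).
Proof.
have [->|n0] := posnP n.
  by rewrite (_ : near_return 0 = set0)//; apply/seteqP; split => x // [].
rewrite (_ : near_return n = (fun x => iter n T x - x) @^-1` `]- psi n, psi n[).
  rewrite -[X in measurable X]setTI.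
  apply: measurable_funB => //; exact: measurable_iter_beta_map.
by apply/seteqP; split => x /=; rewrite /near_return/= in_itv/= ltr_norml; tauto.
Qed.

Lemma recurrence_setE :
  recurrence_set beta psi = `[0, 1] `&` lim_sup_set near_return.
Proof.
apply/seteqP; split => x [x01]; rewrite ?infinite_set_natP => H; split => //.
- by move=> n _; have [k nk Hk] := H n; exists k.
- by apply/infinite_set_natP => n; have [k nk Hk] := H n I; exists k.
Qed.

Lemma measurable_recurrence_set : measurable (recurrence_set beta psi).
Proof.
rewrite recurrence_setE; apply: measurableI; first exact: measurable_itv.
apply: bigcap_measurable => // n _; apply: bigcup_measurable => k _.
exact: measurable_near_return.
Qed.

Lemma recurrence_set_null : (\sum_(1 <= n <oo) (psi n)%:E < +oo)%E ->
  mu (recurrence_set beta psi) = 0%E.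
Proof.
move=> psifin; pose G n := near_return n `&` `[0, 1[.
have mG n : measurable (G n).
  by apply: measurableI; [exact: measurable_near_return|exact: measurable_itv].
have G0 : mu (lim_sup_set G) = 0%E.
  apply: lim_sup_set_cvg0 => //.
  pose C := 2 * (beta / (beta - 1)) ^+ 2.
  have C0 : 0 <= C by rewrite mulr_ge0// sqr_ge0.
  apply: (@le_lt_trans _ _ (C%:E * \sum_(1 <= n <oo) (psi n)%:E)%E); last first.
    by rewrite lte_mul_pinfty// lee_fin.
  rewrite [X in (C%:E * X)%E]eseries_cond -nneseriesZl; last first.
    by move=> n n1; rewrite lee_fin ltW// psi_gt0.
  rewrite [leRHS]eseries_mkcond; apply: lee_nneseries => // n _.
  case: ifPn => /= [n0|].
    rewrite -EFinM; apply: (@return_measure_le _ _ beta_gt1 n) => //.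
      exact: psi_gt0.
    by move=> x [[_ xn]]; rewrite /= in_itv/=.
  rewrite -leqNgt leqn0 => /eqP ->.
  by rewrite (_ : G 0%N = set0) ?measure0//; apply/seteqP; split => x // [[]].
have mG' : measurable (lim_sup_set G).
  by apply: bigcap_measurable => // n _; exact: bigcup_measurable.
have : mu.-negligible (lim_sup_set G `|` [set 1]).
  by apply: negligibleU; apply/negligibleP => //; exact: lebesgue_measure_set1.
move=> neg; apply: measure_negligible; first exact: measurable_recurrence_set.
apply: negligibleS neg.
rewrite recurrence_setE => x [/=]; rewrite in_itv/= => /andP[x0].
rewrite le_eqVlt => /predU1P[->|x1] H; [by right|left] => n nI.
by have [k nk Hk] := H n nI; exists k => //; split => //=; rewrite in_itv/= x0.
Qed.

(** Truncating [psi] at 1 preserves divergence of the sum: over a range of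
    indices where the sum of [delta] stays below 1/2, the truncation is never
    active. *)
Lemma recurrence_set_full : (\sum_(1 <= n <oo) (psi n)%:E = +oo)%E ->
  mu (`[0, 1] `\` recurrence_set beta psi) = 0%E.
Proof.
move=> psioo; pose delta n := if (0 < n)%N then Num.min (psi n) 1 / 2 else 0.
have delta01 n : 0 <= delta n <= 1.
  rewrite /delta; case: ifPn => [n0|]; last by rewrite lexx ler01.
  have : 0 < Num.min (psi n) 1 by rewrite lt_min psi_gt0// ltr01.
  have : Num.min (psi n) 1 <= 1 by rewrite ge_min lexx orbT.
  by move=> ? ?; apply/andP; split; lra.
have delta_lt n : (0 < n)%N -> delta n < psi n.
  move=> n0; rewrite /delta n0.
  have : Num.min (psi n) 1 <= psi n by rewrite ge_min lexx.
  by have := psi_gt0 n0; lra.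
have delta_div m : exists n, 1 / 2 <= \sum_(m <= i < n) delta i.
  apply: contrapT => H.
  have {}H n : \sum_(m <= i < n) delta i < 1 / 2.
    by rewrite ltNge; apply/negP => ?; apply: H; exists n.
  have psiE i : (m < i)%N -> psi i = 2 * delta i.
    move=> mi; have : delta i < 1 / 2.
      apply: le_lt_trans (H i.+1); rewrite big_nat_recr/= ?(ltnW mi)// lerDr.
      by apply: sumr_ge0 => k _; have /andP[] := delta01 k.
    rewrite /delta (leq_ltn_trans _ mi)// /Num.min; case: ifP => _; lra.
  have : (\sum_(1 <= n <oo) (psi n)%:E <= (\sum_(1 <= i < m.+1) psi i + 1)%:E)%E.
    apply: lime_le; first by
      apply: is_cvg_nneseries => n n1 _; rewrite lee_fin ltW// psi_gt0.
    exists m.+1 => // n /= mn.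
    rewrite sumEFin lee_fin (@big_cat_nat _ _ _ m.+1)//= lerD2l.
    rewrite (eq_big_nat _ _ (F2 := fun i => 2 * delta i)); last first.
      by move=> i /andP[mi _]; exact: psiE.
    rewrite -mulr_sumr; have := H n; rewrite big_ltn//.
    by have /andP[] := delta01 m; lra.
  by rewrite psioo leye_eq.
have mh : measurable (lim_sup_set (hits beta delta)).
  apply: bigcap_measurable => // n _; apply: bigcup_measurable => k _.
  exact: measurable_hits.
have : mu.-negligible ((`]0, 1[ `\` lim_sup_set (hits beta delta)) `|`
    ([set 0] `|` [set 1])).
  apply: negligibleU.
    apply/negligibleP; first by apply: measurableD => //; exact: measurable_itv.
    exact: limsup_hits_full.
  by apply: negligibleU; apply/negligibleP => //; exact: lebesgue_measure_set1.
move=> neg; apply: measure_negligible.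
  by apply: measurableD; [exact: measurable_itv|exact: measurable_recurrence_set].
apply: negligibleS neg.
move=> x [/=]; rewrite in_itv/= => /andP[].
  rewrite le_eqVlt => /predU1P[<- _ _|x0]; first by right; left.
  rewrite le_eqVlt => /predU1P[->|x1] xN; first by right; right.
  left; split; first by rewrite /= in_itv/= x0.
  move=> xh; apply: xN; rewrite recurrence_setE; split.
    by rewrite /= in_itv/= !ltW.
  move=> n _; have [k /= nk hk] := xh n.+1 I; exists k; first exact: ltnW.
  have k0 : (0 < k)%N by exact: leq_ltn_trans nk.
  split => //; have [a fa ta] := hitsP beta_gt1 hk.
  exact: target_recur (delta01 k) (delta_lt _ k0) fa ta.
Qed.

Lemma parry_sum_ge0 x : (0 <= parry_sum beta x)%E.
Proof. by apply: nneseries_ge0 => n _ _; rewrite lee_fin expN_ge0. Qed.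

Lemma measurable_parry_sum : measurable_fun [set: R] (parry_sum beta).
Proof.
pose f n x : \bar R := ((beta ^- n)%:E * (\1_`]-oo, iter n T 1[ x)%:E)%E.
have -> : parry_sum beta = fun x => (\sum_(0 <= n <oo) f n x)%E.
  apply/funext => x; rewrite /parry_sum eseries_mkcond; apply: eq_eseriesr => n _.
  by rewrite /f indicE mem_setE in_itv/=; case: ifP; rewrite ?mule1 ?mule0.
apply: (@ge0_emeasurable_sum _ _ _ _ f xpredT) => [n x _ _|n _].
  by rewrite mule_ge0// lee_fin ?indicE// expN_ge0.
apply: emeasurable_funM; first exact: measurable_cst.
exact/measurable_EFinP/measurable_indic.
Qed.

Lemma parry_density_ge0 x : (0 <= parry_density beta x)%E.
Proof.
by rewrite mule_ge0 ?parry_sum_ge0// inve_ge0 ltW// parry_mass_gt0.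
Qed.

Lemma measurable_parry_density : measurable_fun [set: R] (parry_density beta).
Proof.
by apply: emeasurable_funM; [exact: measurable_cst|exact: measurable_parry_sum].
Qed.

Lemma parry_measure_null (A : set R) : measurable A ->
  mu (A `&` `[0, 1]) = 0%E -> parry_measure beta A = 0%E.
Proof.
move=> mA A0; apply: null_set_integral => //.
  by apply: measurableI => //; exact: measurable_itv.
exact: measurable_funTS measurable_parry_density.
Qed.

Lemma parry_measure_full (A : set R) : measurable A ->
  mu (`[0, 1] `\` A) = 0%E -> parry_measure beta A = 1%E.
Proof.
move=> mA A0; rewrite /parry_measure setIC -setDD.
have mD : measurable (`[0, 1] `\` A).
  by apply: measurableD => //; exact: measurable_itv.
transitivity (\int[mu]_(x in `[0%R, 1%R]) parry_density beta x)%E.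
  apply/esym/ge0_negligible_integral => //.
  - exact: measurable_funTS measurable_parry_density.
  - by move=> x _; exact: parry_density_ge0.
rewrite /parry_density ge0_integralZl//.
- by rewrite mulVe ?gt_eqF ?parry_mass_gt0// parry_mass_fin_num.
- exact: measurable_funTS measurable_parry_sum.
- by move=> x _; exact: parry_sum_ge0.
- by rewrite inve_ge0 ltW// parry_mass_gt0.
Qed.

End zero_one_law.

Local Open Scope ring_scope.

Theorem theorem3p1 (R : realType) (beta : R) (psi : nat -> R)
    (beta_gt1 : 1 < beta)
    (psi_gt0 : forall n, (0 < n)%N -> 0 < psi n) :
  ((\sum_(1 <= n <oo) (psi n)%:E < +oo)%E ->
     parry_measure beta (recurrence_set beta psi) = 0%E) /\
  ((\sum_(1 <= n <oo) (psi n)%:E = +oo)%E ->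
     parry_measure beta (recurrence_set beta psi) = 1%E).
Proof.
have mR := measurable_recurrence_set beta_gt1 psi.
split=> Hpsi.
  apply: parry_measure_null => //.
  rewrite setIidl; first exact: recurrence_set_null.
  by move=> x [].
by apply: parry_measure_full => //; exact: recurrence_set_full.
Qed.
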